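(* Let $\alpha\in(0,1]$ and let $x_0$ be a regular $\alpha$ singular point of the equation $$(x-x_0)^{2\alpha}\,T_\alpha^{x_0}T_\alpha^{x_0}y+(x-x_0)^{\alpha}p(x)\,T_\alpha^{x_0}y+q(x)\,y=0, \qquad ( * )$$ so that $$p(x)=\sum_{k=0}^{\infty}p_k(x-x_0)^{k\alpha}\quad (x\in[x_0,x_0+\delta_1];\ \delta_1>0),\qquad q(x)=\sum_{k=0}^{\infty}q_k(x-x_0)^{k\alpha}\quad (x\in[x_0,x_0+\delta_2];\ \delta_2>0).$$ Let $s_1>s_2$ be two distinct real roots of the fractional indicial equation $$I_0(s):=\alpha^2 s(s-1)+\alpha s\,p_0+q_0=0$$ such that $s_1-s_2\neq n$ for $n\in\mathbb{N}$. Then there exist two linearly independent solutions of $( * )$ of the form $$y_1(x;s_1)=\sum_{k=0}^{\infty}c_k(s_1)(x-x_0)^{(k+s_1)\alpha},\qquad y_2(x;s_2)=\sum_{k=0}^{\infty}c_k(s_2)(x-x_0)^{(k+s_2)\alpha}$$ for $x\in(x_0,x_0+\rho)$ with $\rho=\min\{\delta_1,\delta_2\}$, and with initial conditions $c_0=y(x_0)$, $\alpha c_1=(T_\alpha^{x_0} y)(x_0)$. Here, for $s\in\{s_1,s_2\}$, $c_0=c_0(s)\neq 0$ and $$c_k(s)=-\frac{\sum_{j=0}^{k-1}c_j(s)\,I_{k-j}(j+s)}{I_0(k+s)}\quad (k\ge 1),\qquad I_m(s)=\alpha s\,p_m+q_m\quad (m\ge 1).$$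
   Context: For $\alpha\in(0,1]$ and $a\in\mathbb{R}$, the (left) conformable fractional derivative of order $\alpha$ of a function $f:[a,\infty)\to\mathbb{R}$ is $$(T_\alpha^a f)(x)=\lim_{\varepsilon\to0}\frac{f(x+\varepsilon(x-a)^{1-\alpha})-f(x)}{\varepsilon},\qquad x>a$$ (the same definition is used at points $x>a$ for functions defined only on an interval with left endpoint $a$), and at the endpoint $(T_\alpha^a f)(a)=\lim_{x\to a^+}(T_\alpha^a f)(x)$. $T_\alpha^aT_\alpha^a y$ denotes applying $T_\alpha^a$ twice. A real function $f$ is $\alpha$-analytic at $x_0$ if near $x_0$ it can be expressed as a convergent series $\sum_{k\ge0}c_k(x-x_0)^{k\alpha}$ with real $c_k$. For an equation $T_\alpha^{x_0}T_\alpha^{x_0}y+a_1(x)T_\alpha^{x_0}y+a_0(x)y=0$, the point $x_0$ is an $\alpha$-ordinary point if $a_0,a_1$ are $\alpha$-analytic at $x_0$; otherwise it is an $\alpha$ singular point. An $\alpha$ singular point $x_0$ is a regular $\alpha$ singular point if $(x-x_0)^{\alpha}a_1(x)$ and $(x-x_0)^{2\alpha}a_0(x)$ are $\alpha$-analytic at $x_0$. For equation $( * )$ one has $a_1(x)=p(x)/(x-x_0)^{\alpha}$ and $a_0(x)=q(x)/(x-x_0)^{2\alpha}$. In the initial conditions, $c_0$ and $c_1$ are the first two coefficients of the series solution $y$ under consideration.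
   Formalization: The initial conditions c_0 = y(x_0), αc_1 = (T y)(x_0) fail for s ≠ 0 (y tends to 0 or is unbounded at x_0); they are stated for the factor z = (x−x_0)^{−sα} y (value at x_0 as right limit), which is y itself when s = 0. *)

(* Defs.v *)
From HB Require Import structures.
From mathcomp Require Import all_boot all_order all_algebra.
From mathcomp Require Import all_classical all_reals all_analysis.

Set Implicit Arguments.
Unset Strict Implicit.
Unset Printing Implicit Defensive.

Import Order.TTheory GRing.Theory Num.Theory.
Import numFieldNormedType.Exports.

Local Open Scope classical_set_scope.
Local Open Scope ring_scope.

Section conformable.
Variables (R : realType) (alpha a : R).
Implicit Types (f : R -> R) (x : R).

Definition cf_quot f x (e : R) : R :=
  (f (x + e * (x - a) `^ (1 - alpha)) - f x) / e.

Definition cf_derivable_gt f x : Prop := cvg (cf_quot f x e @[e --> 0^']).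

Definition cf_derive_gt f x : R := lim (cf_quot f x e @[e --> 0^']).

(* [lim] is total, so [cf_derive] is meaningful only where [cf_derivable]
   holds; points x < a are never used. *)
Definition cf_derivable f x : Prop :=
  if x == a
  then (\forall t \near a^'+, cf_derivable_gt f t) /\
       cvg (cf_derive_gt f t @[t --> a^'+])
  else cf_derivable_gt f x.

Definition cf_derive f x : R :=
  if x == a then lim (cf_derive_gt f t @[t --> a^'+]) else cf_derive_gt f x.

End conformable.

Section frobenius.
Variables (R : realType) (alpha x0 : R).
Implicit Types (f y p q : R -> R) (c pc qc : nat -> R).

Definition frac_series c x : R^nat :=
  series (fun k => c k * (x - x0) `^ (k%:R * alpha)).

Definition frobenius_series c (s x : R) : R^nat :=
  series (fun k => c k * (x - x0) `^ ((k%:R + s) * alpha)).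

(* "Near x0" is a right neighbourhood, (x - x0)^(k alpha) being real only for
   x >= x0. The point x0 is left out because the coefficients a1, a0 below
   carry a negative power of x - x0 and have no value there. *)
Definition alpha_analytic f : Prop :=
  exists c, exists2 r : R, 0 < r &
    forall x, x0 < x < x0 + r -> frac_series c x @ \oo --> f x.

(* Points of T T y + a1 T y + a0 y = 0. *)
Definition alpha_ordinary (a1 a0 : R -> R) : Prop :=
  alpha_analytic a0 /\ alpha_analytic a1.

Definition alpha_singular (a1 a0 : R -> R) : Prop := ~ alpha_ordinary a1 a0.

Definition regular_alpha_singular (a1 a0 : R -> R) : Prop :=
  [/\ alpha_singular a1 a0,
      alpha_analytic (fun x => (x - x0) `^ alpha * a1 x) &
      alpha_analytic (fun x => (x - x0) `^ (2 * alpha) * a0 x)].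

Definition is_solution_on (D : set R) p q y : Prop :=
  forall x, D x ->
    [/\ cf_derivable alpha x0 y x,
        cf_derivable alpha x0 (cf_derive alpha x0 y) x &
        (x - x0) `^ (2 * alpha) *
          cf_derive alpha x0 (cf_derive alpha x0 y) x
        + (x - x0) `^ alpha * p x * cf_derive alpha x0 y x
        + q x * y x = 0].

Definition indicial0 pc qc (s : R) : R :=
  alpha ^+ 2 * s * (s - 1) + alpha * s * pc 0%N + qc 0%N.

(* I_m for m >= 1 *)
Definition indicial pc qc (m : nat) (s : R) : R := alpha * s * pc m + qc m.

Definition frobenius_coefs pc qc (s : R) c : Prop :=
  forall k : nat, (1 <= k)%N ->
    c k = - (\sum_(0 <= j < k) c j * indicial pc qc (k - j) (j%:R + s))
          / indicial0 pc qc (k%:R + s).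

(* y = (x - x0)^(s alpha) z, where z is the factor whose expansion in powers
   of (x - x0)^alpha has first coefficients c_0 and c_1. *)
Definition frobenius_factor (s : R) y : R -> R :=
  fun x => (x - x0) `^ (- (s * alpha)) * y x.

(* c_0 = y(x0) and alpha c_1 = (T y)(x0), read for the factor z: for s <> 0
   the solution y itself vanishes or is unbounded at x0 although c_0 <> 0.
   The value z(x0) is the limit at x0 from the right. For s = 0, z is y. *)
Definition initial_conditions (s : R) c y : Prop :=
  let z := frobenius_factor s y in
  [/\ z x @[x --> x0^'+] --> c 0%N,
      s = 0 -> y x0 = c 0%N,
      cf_derivable alpha x0 z x0 &
      cf_derive alpha x0 z x0 = alpha * c 1%N].

End frobenius.

Definition lin_indep_on (R : realType) (D : set R) (y1 y2 : R -> R) : Prop :=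
  forall u v : R, (forall x, D x -> u * y1 x + v * y2 x = 0) ->
    u = 0 /\ v = 0.

(* Main.v *)
Require Import Defs.
From HB Require Import structures.
From mathcomp Require Import all_boot all_order all_algebra.
From mathcomp Require Import all_classical all_reals all_analysis.
From mathcomp Require Import ring lra.

Import Order.TTheory GRing.Theory Num.Theory.
Import numFieldNormedType.Exports.

Local Open Scope classical_set_scope.
Local Open Scope ring_scope.

(** The substitution t = (x - x0)^alpha turns the conformable derivative into
    alpha d/dt: if f(x) = g((x - x0)^alpha), the factor (x - x0)^(1 - alpha)
    in the difference quotient cancels the derivative of t up to the constant
    alpha, so (T f)(x) = alpha g'(t) ([cf_derive_gt_comp]).  The equation
    becomes the classical Fuchs equation
      alpha^2 t^2 g'' + alpha t P(t) g' + Q(t) g = 0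
    on 0 < t < rho^alpha, where P and Q are ordinary power series, and the
    theorem is Frobenius' method for g(t) = t^s sum c_k t^k.

    Convergence.  The two roots factor the indicial polynomial as
    I_0(r) = alpha^2 (r - s)(r - s'), hence I_0(k + s) grows like k^2, while
    the numerator of the recurrence is at most k times a convolution of the
    earlier coefficients with a geometric sequence.  For r below the radius of
    P and Q an induction then bounds |c_k| r^k by its values at the finitely
    many small k ([frobenius_coefs_cvg]).

    Equation.  Differentiating t^s sum c_k t^k multiplies c_k by k + s and
    lowers the exponent s by one ([powR_pser_is_derive]); two applications and
    two Cauchy products ([cvg_cauchy_prod]) show that the left-hand side is
    t^s times the power series with coefficients
      I_0(k + s) c_k + sum_(j < k) c_j I_(k - j)(j + s),
    which the recurrence makes zero for k > 0 and I_0(s) = 0 for k = 0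
    ([frobenius_ode]).  No denominator I_0(k + s) vanishes, because k + s1
    exceeds both roots, and k + s2 = s1 would make s1 - s2 a natural number.

    Behaviour at x0.  The factor z(x) = sum c_k t^k tends to c_0, and
    T z = alpha sum (k + 1) c_(k+1) t^k tends to alpha c_1.  In a linear
    relation u y1 + v y2 = 0, division by t^s2 and the limit at x0 leave
    v c_0(s2) = 0, since t^(s1 - s2) tends to 0; then u c_0(s1) = 0 likewise
    ([frobenius_lin_indep]). *)

(** * Power series on an interval [0, rho) *)

Section PowerSeries.
Context {R : realType}.
Implicit Types (a b c d : nat -> R) (r t x M : R).

(** Radius of convergence at least [rho], without naming the radius.  Only
    positive arguments are asked for; they control the negative ones. *)
Definition cvg_below c rho := forall r, 0 < r < rho -> cvgn (pseries c r).

Definition pser c t : R := limn (pseries c t).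

(** Bernoulli's inequality for r' / r = 1 + e gives k e <= (r' / r)^k: a factor
    k costs an arbitrarily small loss of radius. *)
Lemma natr_exp_dominated {r r' : R} : 0 < r -> r < r' ->
  exists2 B : R, 0 <= B & forall k, k%:R * r ^+ k <= B * r' ^+ k.
Proof.
move=> r0 rr'; pose e := r' / r - 1.
have e0 : 0 < e by rewrite subr_gt0 ltr_pdivlMr// mul1r.
have bern k : k%:R * e <= (1 + e) ^+ k.
  elim: k => [|k IH]; first by rewrite mul0r expr0.
  rewrite exprS mulrDl mul1r -natr1 mulrDl mul1r lerD// ler_peMr ?(ltW e0)//.
  by rewrite exprn_ege1// lerDl ltW.
exists e^-1 => [|k]; first by rewrite invr_ge0 ltW.
have -> : r' = (1 + e) * r by rewrite /e addrC subrK divfK// gt_eqF.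
rewrite exprMn mulrA ler_wpM2r ?exprn_ge0 ?(ltW r0)//.
by rewrite mulrC ler_pdivlMr.
Qed.

Lemma cvg_pseries_bounded {c r} : cvgn (pseries c r) -> 0 <= r ->
  exists2 M, 0 <= M & forall k, `|c k| * r ^+ k <= M.
Proof.
move=> /cvg_series_bounded[M [_ Mb]] r0.
have Mb' k : `|c k| * r ^+ k <= `|M| + 1.
  rewrite -[X in _ * X]ger0_norm ?exprn_ge0// -normrM.
  by apply: Mb => //; rewrite (le_lt_trans (ler_norm _))// ltrDl.
by exists (`|M| + 1) => //; rewrite addr_ge0.
Qed.

(** Abel's lemma.  Geometric bounds are easier to propagate through products
    and recurrences than convergence itself. *)
Lemma cvg_belowP c rho :
  cvg_below c rho <->
  forall r, 0 < r < rho -> exists2 M, 0 <= M & forall k, `|c k| * r ^+ k <= M.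
Proof.
split=> [cc r /[dup] /cc + /andP[r0 _]|cb r /andP[r0 rrho]].
  by move=> /cvg_pseries_bounded; apply; exact: ltW.
have [r' rr' r'rho] : exists2 r', r < r' & r' < rho by exists ((r + rho) / 2); lra.
have r'0 : 0 < r' by lra.
have [M M0 Mb] := cb r' (introT andP (conj r'0 r'rho)).
apply: normed_cvg; rewrite /normed_series_of /=.
apply: (series_le_cvg (v_ := geometric M (r / r'))) => // k.
- by rewrite /= mulr_ge0// exprn_ge0// divr_ge0// ltW.
- rewrite /= normrM normrX (gtr0_norm r0) expr_div_n mulrA ler_pdivlMr ?exprn_gt0//.
  by rewrite mulrAC ler_wpM2r// exprn_ge0// ltW.
- by apply: is_cvg_geometric_series; rewrite ger0_norm ?divr_ge0 ?ltW// ltr_pdivrMr ?mul1r.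
Qed.

Lemma cvg_below_mulnD c rho x :
  cvg_below c rho -> cvg_below (fun k => (k%:R + x) * c k) rho.
Proof.
move=> /cvg_belowP cb; apply/cvg_belowP => r /andP[r0 rrho].
have [r' rr' r'rho] : exists2 r', r < r' & r' < rho by exists ((r + rho) / 2); lra.
have r'0 : 0 < r' by lra.
have [M M0 Mb] := cb r' (introT andP (conj r'0 r'rho)).
have [B B0 Bb] := natr_exp_dominated r0 rr'.
exists ((B + `|x|) * M) => [|k]; first by rewrite mulr_ge0// addr_ge0.
rewrite normrM mulrAC (le_trans (y := ((B + `|x|) * r' ^+ k) * `|c k|))//.
  rewrite ler_wpM2r//.
  rewrite (le_trans (y := (k%:R + `|x|) * r ^+ k))//.
    rewrite ler_wpM2r ?exprn_ge0 ?(ltW r0)// (le_trans (ler_normD _ _))//.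
    by rewrite normr_nat.
  rewrite !mulrDl lerD// ler_wpM2l// lerXn2r// ?qualifE/= ?ltW//.
rewrite -mulrA ler_wpM2l ?addr_ge0//.
by rewrite mulrC.
Qed.

Lemma cvg_below_diffs c rho :
  cvg_below c rho -> cvg_below (pseries_diffs c) rho.
Proof.
move=> /(cvg_below_mulnD _ _ 0) /cvg_belowP cb; apply/cvg_belowP => r r0rho.
have /andP[r0 _] := r0rho.
have [M M0 Mb] := cb r r0rho.
exists (M / r) => [|k]; first by rewrite divr_ge0// ltW.
by rewrite ler_pdivlMr// -mulrA -exprSr (le_trans _ (Mb k.+1))// addr0.
Qed.

(** Term by term differentiation asks for the convergence of the series and of
    its first two formal derivatives at a single radius beyond [`|t|]; the
    midpoint of [`|t|] and [rho] serves. *)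
Lemma pser_is_derive c rho t : cvg_below c rho -> `|t| < rho ->
  is_derive t 1 (pser c) (pser (pseries_diffs c) t).
Proof.
move=> cc trho; have t0 := normr_ge0 t.
have rP : 0 < (`|t| + rho) / 2 < rho by lra.
apply: (@pseries_snd_diffs _ _ ((`|t| + rho) / 2)).
- exact: cc rP.
- exact: cvg_below_diffs cc _ rP.
- exact: cvg_below_diffs (cvg_below_diffs _ _ cc) _ rP.
- by rewrite (@gtr0_norm _ (_ / _)); lra.
Qed.

Lemma pser0 c : pser c 0 = c 0%N.
Proof.
apply: (@lim_near_cst _ (@norm_hausdorff _ R)) => //; near=> n.
have n0 : (0 < n)%N by near: n; exact: nbhs_infty_gt.
rewrite -(prednK n0) /pseries /series/= big_nat_recl//= expr0 mulr1 big1 ?addr0//.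
by move=> i _; rewrite expr0n mulr0.
Unshelve. all: by end_near. Qed.

Lemma pser_continuous0 c rho : 0 < rho -> cvg_below c rho ->
  pser c t @[t --> 0] --> c 0%N.
Proof.
move=> rho0 cc; rewrite -pser0.
have /derivable1_diffP/differentiable_continuous : derivable (pser c) 0 1.
  by have [] := pser_is_derive _ _ 0 cc (eq_ind_r (fun u => u < rho) rho0 (normr0 _)).
exact.
Qed.
Lemma pseries_tail {a r t M} : 0 < t < r -> cvgn (pseries a t) ->
    (forall k, `|a k| * r ^+ k <= M) ->
  forall m, `|pser a t - pseries a t m| <= M / (1 - t / r) * (t / r) ^+ m.
Proof.
move=> /andP[t0 tr] ca Mb m; have r0 : 0 < r by lra.
have M0 : 0 <= M by apply: le_trans (Mb 0%N); rewrite mulr_ge0// exprn_ge0// ltW.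
set q := t / r; have q0 : 0 < q by rewrite divr_gt0.
have q1 : q < 1 by rewrite ltr_pdivrMr ?mul1r.
have term k : `|a k * t ^+ k| <= M * q ^+ k.
  rewrite normrM normrX (gtr0_norm t0) expr_div_n mulrA ler_pdivlMr ?exprn_gt0//.
  by rewrite mulrAC ler_wpM2r// exprn_ge0// ltW.
have cvgd : `|pseries a t n - pseries a t m| @[n --> \oo] -->
    `|pser a t - pseries a t m|.
  by apply: cvg_norm; apply: cvgB; [exact: ca|exact: cvg_cst].
rewrite -(cvg_lim (@norm_hausdorff _ R) cvgd).
apply: limr_le; first by apply/cvg_ex; exists `|pser a t - pseries a t m|.
near=> n.
have mn : (m <= n)%N by near: n; exact: nbhs_infty_ge.
rewrite /pseries /series/= (big_cat_nat _ mn)//= addrAC subrr add0r.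
rewrite (le_trans (ler_norm_sum _ _ _))//.
rewrite (le_trans (y := \sum_(m <= i < n) M * q ^+ i))//.
  by apply: ler_sum => i _; exact: term.
rewrite -mulr_sumr -mulrA ler_wpM2l// -(subnKC mn) geometric_partial_tail.
rewrite [leRHS]mulrC; apply: geometric_le_lim => //; first by rewrite exprn_ge0// ltW.
by rewrite gtr0_norm.
Unshelve. all: by end_near. Qed.

Lemma cvg_natr_geometric (q : R) : 0 < q -> q < 1 -> (n%:R * q ^+ n : R) @[n --> \oo] --> 0.
Proof.
move=> q0 q1; have [q' qq' q'1] : exists2 q', q < q' & q' < 1 by exists ((q + 1) / 2); lra.
have [B B0 Bb] := natr_exp_dominated q0 qq'.
apply: (squeeze_cvgr (f := fun=> 0) (h := geometric B q')).
- by near=> n; rewrite Bb mulr_ge0// exprn_ge0// ltW.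
- exact: cvg_cst.
- by apply: cvg_geometric; rewrite ger0_norm//; lra.
Unshelve. all: by end_near. Qed.

(** * Cauchy product *)
Definition cauchy_prod a b n := \sum_(0 <= j < n.+1) a (n - j)%N * b j.

(** Summing the triangle i + j < n by columns, as in the proof of Mertens'
    theorem: the partial sums of [a] appear with complementary lengths. *)
Lemma pseries_cauchy_prod a b t n : pseries (cauchy_prod a b) t n =
  \sum_(0 <= j < n) b j * t ^+ j * pseries a t (n - j)%N.
Proof.
elim: n => [|n IH]; first by rewrite /pseries /series/= !big_geq.
rewrite /pseries seriesSr -/(pseries _ _ _) IH big_nat_recr//=.
rewrite subSnn /cauchy_prod big_distrl/= [X in _ + X]big_nat_recr//=.
rewrite subnn addrA -big_split/=; congr (_ + _).
  apply: eq_big_nat => j /andP[_ jn]; rewrite subSn ?(ltnW jn)//.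
  rewrite /pseries seriesSr mulrDr; congr (_ + _).
  have -> : t ^+ n = t ^+ j * t ^+ (n - j)%N by rewrite -exprD subnKC// ltnW.
  ring.
by rewrite /pseries /series/= big_nat1 expr0; ring.
Qed.

(** By [pseries_cauchy_prod] the error is the sum over j < n of the products
    of b_j t^j with the tails of [a] from n - j on.  With q = t / r both factors
    decay geometrically, as q^j and q^(n - j), so each of the n terms is
    O(q^n). *)
Lemma cvg_cauchy_prod a b rho t : cvg_below a rho -> cvg_below b rho ->
  0 < t < rho ->
  pseries (cauchy_prod a b) t @ \oo --> pser a t * pser b t.
Proof.
move=> ca cb /[dup] t0rho /andP[t0 trho].
have [r tr rrho] : exists2 r, t < r & r < rho by exists ((t + rho) / 2); lra.
have r0 : 0 < r by lra.
have [M M0 Ma] := (cvg_belowP a rho).1 ca r (introT andP (conj r0 rrho)).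
have [N N0 Nb] := (cvg_belowP b rho).1 cb r (introT andP (conj r0 rrho)).
have tail := pseries_tail (introT andP (conj t0 tr)) (ca t t0rho) Ma.
set K := M / _ in tail; set q := t / r in tail.
have q0 : 0 < q by rewrite divr_gt0.
have q1 : q < 1 by rewrite ltr_pdivrMr ?mul1r.
have K0 : 0 <= K by rewrite divr_ge0// subr_ge0 ltW.
apply: (@cvg_sub0 _ _ _ _ _ _ (fun n => pser a t * pseries b t n)); last first.
  by apply: cvgMr; exact: cb.
rewrite (_ : _ - _ = fun n => - (\sum_(0 <= j < n)
    b j * t ^+ j * (pser a t - pseries a t (n - j)%N))); last first.
  apply/funext => n; rewrite /= -[LHS]opprB; congr (- _).
  rewrite /= pseries_cauchy_prod /pseries {1}/series/= mulr_sumr -sumrB.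
  by apply: eq_bigr => j _; rewrite mulrBr mulrC.
rewrite -[X in _ --> X]oppr0; apply: cvgN.
apply/norm_cvg0P.
apply: (squeeze_cvgr (f := fun=> 0) (h := fun n => (N * K) * (n%:R * q ^+ n))).
- near=> n; rewrite normr_ge0/= (le_trans (ler_norm_sum _ _ _))//.
  rewrite (le_trans (y := \sum_(0 <= j < n) N * K * q ^+ n))//; last first.
    by rewrite sumr_const_nat subn0 -[leLHS]mulr_natr mulrAC -mulrA.
  apply: ler_sum_nat => j /andP[_ jn].
  have -> : N * K * q ^+ n = (N * q ^+ j) * (K * q ^+ (n - j)%N).
    by rewrite mulrACA -exprD subnKC// ltnW.
  rewrite normrM ler_pM//.
  rewrite normrM normrX (gtr0_norm t0) expr_div_n mulrA ler_pdivlMr ?exprn_gt0//.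
  by rewrite mulrAC ler_wpM2r// exprn_ge0// ltW.
- exact: cvg_cst.
- rewrite -[X in _ --> X](mulr0 (N * K)); apply: cvgMl_tmp.
  exact: cvg_natr_geometric.
Unshelve. all: by end_near. Qed.
(** * Differentiating t^x times a power series *)
Lemma pser_mulnD c rho x t : cvg_below c rho -> 0 < t < rho ->
  pser (fun k => (k%:R + x) * c k) t = t * pser (pseries_diffs c) t + x * pser c t.
Proof.
move=> cc t0rho; apply: (cvg_lim (@norm_hausdorff _ R)).
have h1 := pseries_diffs_equiv (cvg_below_diffs _ _ cc _ t0rho).
have h2 := cvgD (cvgMl_tmp (a := t) h1) (cvgMl_tmp (a := x) (cc _ t0rho)).
suff -> : pseries (fun k => (k%:R + x) * c k) t = (fun n =>
    t * series (fun i => i%:R * c i * t ^+ i.-1) n + x * pseries c t n).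
  exact: h2.
apply/funext => n; rewrite /pseries /series/= !mulr_sumr -big_split/=.
apply: eq_bigr => -[|k] _; first by rewrite !expr0; ring.
by rewrite exprS/=; ring.
Qed.

(** The form in which the rule can be iterated: the derivative is again a real
    power times a power series with the same lower bound on its radius. *)
Lemma powR_pser_is_derive c rho x t : cvg_below c rho -> 0 < t < rho ->
  is_derive t 1 (fun u => u `^ x * pser c u)
    (t `^ (x - 1) * pser (fun k => (k%:R + x) * c k) t).
Proof.
move=> cc /[dup] t0rho /andP[t0 trho].
have trho' : `|t| < rho by rewrite gtr0_norm.
apply: is_derive_eq (is_deriveM (is_derive1_powR x t0) (pser_is_derive _ _ _ cc trho')) _.
rewrite (pser_mulnD _ _ _ _ cc t0rho) /GRing.scale/=.
rewrite mulrDr mulrA [t `^ (x - 1) * t]mulrC.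
have -> : t * t `^ (x - 1) = t `^ x.
  by rewrite -{1}(powRr1 (ltW t0)) -powRD ?subrKC// (gt_eqF t0) implybT.
by ring.
Qed.

End PowerSeries.

(** * The conformable derivative as alpha d/dt *)
Section Conformable.
Context {R : realType}.
Variables (alpha x0 : R).

(** Caratheodory's form f z - f x = phi z (z - x) of differentiability makes
    the quotient equal to phi (x + e m) m for e != 0, with m the power
    (x - x0)^(1 - alpha).  Since the derivative of (x - x0)^alpha is alpha / m,
    only alpha times the derivative of g remains. *)
Lemma cf_quot_comp (f g : R -> R) x l : x0 < x ->
    is_derive ((x - x0) `^ alpha) 1 g l ->
    (\forall z \near x, f z = g ((z - x0) `^ alpha)) ->
  cf_quot alpha x0 f x e @[e --> 0^'] --> alpha * l.
Proof.
move=> x0x dg fg; have xx0 : 0 < x - x0 by rewrite subr_gt0.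
have dsub : is_derive x 1 (fun z : R => z - x0) 1.
  by apply: is_derive_eq; rewrite subr0.
have dpow := is_derive1_comp (f := @powR R ^~ alpha) (g := fun z => z - x0)
  (is_derive1_powR alpha xx0) dsub.
have df : is_derive x 1 f (l * (alpha * (x - x0) `^ (alpha - 1) * 1)).
  apply: near_eq_is_derive (is_derive1_comp
    (g := @powR R ^~ alpha \o (fun z => z - x0)) dg dpow).
  by apply: filterS fg => z /= ->.
have [phi [phiE phic phix]] := (is_derive1_caratheodory _ _ _).1 df.
set m := (x - x0) `^ (1 - alpha).
have m0 : m != 0 by rewrite gt_eqF// powR_gt0.
have -> : alpha * l = phi x * m.
  have -> : m = ((x - x0) `^ (alpha - 1))^-1 by rewrite -powRN opprB.
  by rewrite phix mulr1; field; rewrite gt_eqF// powR_gt0.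
have : phi (x + e * m) * m @[e --> 0^'] --> phi x * m.
  apply: cvgMr_tmp; apply: cvg_within_filter.
  have : x + e * m @[e --> 0] --> x.
    rewrite -[X in _ --> X]addr0 -[X in _ --> _ + X](mul0r m).
    by apply: cvgD; [exact: cvg_cst|exact: cvgMr_tmp].
  by move=> /cvg_comp; apply.
apply: cvg_trans; apply: near_eq_cvg; near=> e.
have e0 : e != 0 by near: e; exact: nbhs_dnbhs_neq.
by rewrite /cf_quot phiE -/m; field.
Unshelve. all: by end_near. Qed.

Lemma cf_derive_gt_comp (f g : R -> R) x l : x0 < x ->
    is_derive ((x - x0) `^ alpha) 1 g l ->
    (\forall z \near x, f z = g ((z - x0) `^ alpha)) ->
  cf_derivable_gt alpha x0 f x /\ cf_derive_gt alpha x0 f x = alpha * l.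
Proof.
move=> x0x dg fg; have h := cf_quot_comp f g x l x0x dg fg.
split; first by apply/cvg_ex; exists (alpha * l).
exact: (cvg_lim (@norm_hausdorff _ R)).
Qed.

End Conformable.

(** * The recurrence and its convergence *)

(** Stage n agrees with the wanted sequence up to index n. *)
Lemma course_of_values_seq {T : Type} (F : nat -> (nat -> T) -> T) (b : T) :
    (forall k c c', (forall j, (j < k)%N -> c j = c' j) -> F k c = F k c') ->
  exists2 c : nat -> T, c 0%N = b & forall k, (0 < k)%N -> c k = F k c.
Proof.
move=> Fext.
pose fix stage n : nat -> T :=
  if n is m.+1 then fun k => if (k <= m)%N then stage m k else F k (stage m)
  else fun=> b.
have stable n k : (k <= n)%N -> stage n k = stage k k.
  elim: n => [|n IH]; first by rewrite leqn0 => /eqP ->.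
  by rewrite leq_eqVlt => /predU1P[->//|]; rewrite ltnS /= => kn; rewrite kn IH.
exists (fun k => stage k k) => // -[//|k] _ /=; rewrite ltnn.
by apply: Fext => j; rewrite ltnS => jk; rewrite stable.
Qed.
Section Recurrence.
Context {R : realType}.
Variables (alpha : R) (pc qc : nat -> R).
Implicit Types (c : nat -> R) (s t rho : R).

Lemma frobenius_coefs_exist s b :
  exists2 c, c 0%N = b & frobenius_coefs alpha pc qc s c.
Proof.
have [k c c' cc'|c c0 cE] := @course_of_values_seq R (fun k c =>
  - (\sum_(0 <= j < k) c j * indicial alpha pc qc (k - j) (j%:R + s))
    / indicial0 alpha pc qc (k%:R + s)) b.
  by congr (- _ / _); apply: eq_big_nat => j /andP[_ jk]; rewrite cc'.
by exists c.
Qed.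

Hypothesis alpha_gt0 : 0 < alpha.

(** The linear growth of I_m(j + s) in j < k is absorbed in the factor k, which
    leaves a constant [N] that depends on neither m, j nor k. *)
Lemma indicial_bound rho r s : cvg_below pc rho -> cvg_below qc rho ->
    0 < r < rho ->
  exists2 N, 0 <= N & forall m j k : nat, (j < k)%N ->
    `|indicial alpha pc qc m (j%:R + s)| * r ^+ m <= k%:R * N.
Proof.
move=> /cvg_belowP pb /cvg_belowP qb /[dup] r0rho /andP[r0 _].
have [M1 M10 Mp] := pb r r0rho; have [M2 M20 Mq] := qb r r0rho.
exists (alpha * (1 + `|s|) * M1 + M2) => [|m j k jk].
  by rewrite addr_ge0// !mulr_ge0// ?addr_ge0// ltW.
have k1 : 1 <= k%:R :> R by rewrite ler1n (leq_ltn_trans _ jk).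
have sk : `|j%:R + s| <= k%:R * (1 + `|s|).
  rewrite (le_trans (ler_normD _ _))// normr_nat mulrDr mulr1 lerD ?ler_nat 1?ltnW//.
  by rewrite ler_peMl.
rewrite (le_trans (y := (alpha * `|j%:R + s| * `|pc m| + `|qc m|) * r ^+ m))//.
  rewrite ler_wpM2r ?exprn_ge0 ?(ltW r0)// (le_trans (ler_normD _ _))//.
  by rewrite !normrM (gtr0_norm alpha_gt0).
rewrite mulrDl mulrDr lerD//; last by rewrite (le_trans (Mq m))// ler_peMl.
rewrite -mulrA (le_trans (y := alpha * (k%:R * (1 + `|s|)) * M1))//.
  rewrite ler_pM// ?mulr_ge0 ?exprn_ge0 ?(ltW alpha_gt0) ?(ltW r0)//.
  by rewrite ler_wpM2l// ltW.
by rewrite le_eqVlt; apply/orP; left; apply/eqP; ring.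
Qed.

(** With r < r' below the radius of [pc] and [qc] and q = r / r', a bound B
    on |c_j| r^j for j < k gives
      |c_k| r^k <= B k N (q + q^2 + ...) / I_0(k + s),
    and the right-hand side is at most B as soon as
    N q / (1 - q) <= alpha^2 (k + s - s').  This holds from some K on, so B
    can be any bound valid for j < K; their sum is taken. *)
Lemma frobenius_coefs_cvg rho s s' c :
    cvg_below pc rho -> cvg_below qc rho ->
    (forall k : nat, indicial0 alpha pc qc (k%:R + s) =
       alpha ^+ 2 * k%:R * (k%:R + s - s')) ->
    frobenius_coefs alpha pc qc s c ->
  cvg_below c rho.
Proof.
move=> pcv qcv ind0E cE; apply/cvg_belowP => r /andP[r0 rrho].
have [r' rr' r'rho] : exists2 r', r < r' & r' < rho by exists ((r + rho) / 2); lra.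
have r'0 : 0 < r' by lra.
have [N N0 indN] := indicial_bound rho r' s pcv qcv (introT andP (conj r'0 r'rho)).
set q := r / r'; have q0 : 0 < q by rewrite divr_gt0.
have q1 : q < 1 by rewrite ltr_pdivrMr ?mul1r.
have [X X0 XE] : exists2 X, 0 <= X & alpha ^+ 2 * X = N * (q / (1 - q)).
  exists (N * (q / (1 - q)) / alpha ^+ 2); last first.
    by rewrite mulrC divfK// expf_neq0// gt_eqF.
  have q_ge0 : 0 <= q / (1 - q) by apply: divr_ge0; [exact: ltW|rewrite subr_ge0 ltW].
  by apply: divr_ge0; [exact: mulr_ge0|apply: exprn_ge0; exact: ltW].
pose L := X + `|s' - s|.
pose K := (Num.truncn L).+1.
have LK k : (K <= k)%N -> L < k%:R.
  by move=> Kk; rewrite (lt_le_trans (truncnS_gt L))// ler_nat.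
pose B := \sum_(0 <= j < K) `|c j| * r ^+ j.
have B0 : 0 <= B by apply: sumr_ge0 => j _; rewrite mulr_ge0// exprn_ge0// ltW.
exists B => // k; elim/ltn_ind: k => k IH.
have [kK|Kk] := ltnP k K.
  rewrite /B (big_cat_nat _ (ltnW kK))//= [X in _ + X]big_ltn//= addrCA lerDl.
  by apply: addr_ge0; apply: sumr_ge0 => j _; rewrite mulr_ge0// exprn_ge0// ltW.
have k0 : (0 < k)%N by rewrite (leq_trans _ Kk).
have k0R : 0 < k%:R :> R by rewrite ltr0n.
have kL := LK k Kk.
(* For k < K the bound holds by the choice of B; from here on K <= k. *)
have Xk : X < k%:R + s - s'.
  by have := LK k Kk; have := ler_norm (s' - s); rewrite /L; lra.
have den0 : 0 < indicial0 alpha pc qc (k%:R + s).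
  by rewrite ind0E !mulr_gt0 ?exprn_gt0// (le_lt_trans X0).
have denE : k%:R * (N * (q / (1 - q))) <= indicial0 alpha pc qc (k%:R + s).
  rewrite ind0E -XE mulrCA mulrA ler_wpM2l ?(ltW Xk)//.
  by rewrite mulr_ge0 ?exprn_ge0 ?(ltW alpha_gt0).
rewrite cE// normrM normrN normfV (gtr0_norm den0) mulrAC ler_pdivrMr//.
apply: le_trans (ler_wpM2l B0 denE).
(* The exponents k - j run through 1, ..., k. *)
have geo : \sum_(0 <= j < k) q ^+ (k - j) <= q / (1 - q).
  rewrite big_nat_rev/= add0n.
  rewrite (eq_big_nat _ _ (F2 := geometric q q)) => [|j /andP[_ jk]].
    by apply: geometric_le_lim; rewrite ?ltW ?gtr0_norm.
  by rewrite subKn//= exprS.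
apply: le_trans (ler_wpM2l B0 (ler_wpM2l (ltW k0R) (ler_wpM2l N0 geo))).
rewrite !mulr_sumr.
apply: le_trans (ler_wpM2r (exprn_ge0 k (ltW r0)) (ler_norm_sum _ _ _)) _.
rewrite mulr_suml; apply: ler_sum_nat => j /andP[_ jk].
have -> : r ^+ k = r ^+ j * (r' ^+ (k - j)%N * q ^+ (k - j)%N).
  rewrite -exprMn [r' * q]mulrC divfK ?gt_eqF// -exprD subnKC//.
  exact: ltnW.
rewrite normrM mulrACA; apply: ler_pM => //.
- by rewrite mulr_ge0// exprn_ge0// ltW.
- by rewrite !mulr_ge0// exprn_ge0// ltW.
- exact: IH.
- by rewrite !mulrA ler_wpM2r ?exprn_ge0 ?(ltW q0)// indN.
Qed.

(** The differential equation with t^s divided out.  The t^k coefficient of the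
    left-hand side is I_0(k + s) c_k plus the sum of c_j I_(k - j)(j + s) over
    j < k: the diagonal terms j = k of both Cauchy products complete
    alpha^2 (k + s)(k + s - 1) to I_0(k + s). *)
Lemma frobenius_ode rho s c t :
    cvg_below pc rho -> cvg_below qc rho -> cvg_below c rho ->
    indicial0 alpha pc qc s = 0 ->
    (forall k : nat, (0 < k)%N -> indicial0 alpha pc qc (k%:R + s) != 0) ->
    frobenius_coefs alpha pc qc s c -> 0 < t < rho ->
  alpha ^+ 2 * pser (fun k => (k%:R + (s - 1)) * ((k%:R + s) * c k)) t
  + alpha * (pser pc t * pser (fun k => (k%:R + s) * c k) t)
  + pser qc t * pser c t = 0.
Proof.
move=> pcv qcv ccv ind0s ind0k cE t0rho.
have dcv := cvg_below_mulnD _ _ s ccv.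
have ddcv := cvg_below_mulnD _ _ (s - 1) dcv.
have h := cvgD (cvgD (cvgMl_tmp (a := alpha ^+ 2) (ddcv _ t0rho))
  (cvgMl_tmp (a := alpha) (cvg_cauchy_prod _ _ _ _ pcv dcv t0rho)))
  (cvg_cauchy_prod _ _ _ _ qcv ccv t0rho).
rewrite -[LHS](cvg_lim (@norm_hausdorff _ R) (h _ _ _ _)).
apply: lim_near_cst => //; near=> n; rewrite /= /pseries /series/= !fctE !mulr_sumr -!big_split/=.
apply: big1 => k _.
suff : alpha ^+ 2 * ((k%:R + (s - 1)) * ((k%:R + s) * c k))
  + alpha * cauchy_prod pc (fun j => (j%:R + s) * c j) k
  + cauchy_prod qc c k = 0.
  by move=> ck0; rewrite -[RHS](mul0r (t ^+ k)) -ck0; ring.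
suff : (\sum_(0 <= j < k) c j * indicial alpha pc qc (k - j) (j%:R + s))
    + indicial0 alpha pc qc (k%:R + s) * c k = 0.
  move=> <-; rewrite /cauchy_prod mulr_sumr !big_nat_recr//= subnn.
  have -> : \sum_(0 <= j < k) c j * indicial alpha pc qc (k - j) (j%:R + s) =
      \sum_(0 <= j < k) alpha * (pc (k - j)%N * ((j%:R + s) * c j))
      + \sum_(0 <= j < k) qc (k - j)%N * c j.
    by rewrite -big_split/=; apply: eq_bigr => j _; rewrite /indicial; ring.
  by rewrite /indicial0; ring.
case: (posnP k) => [->|k0]; first by rewrite big_geq// add0r add0r ind0s mul0r.
rewrite [in X in _ + X]cE// mulrC divfK ?ind0k//.
by rewrite subrr.
Unshelve. all: by end_near. Qed.


End Recurrence.
(** * Frobenius series in the variable x *)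
Section Frobenius.
Context {R : realType}.
Variables (alpha x0 : R).
Hypothesis alpha_gt0 : 0 < alpha.
Implicit Types (c : nat -> R) (s x d : R) (f y : R -> R).

Lemma cvg_subr_at_right : x - x0 @[x --> x0^'+] --> 0^'+.
Proof.
move=> A A0; apply/nbhs_right0P; near=> e.
by rewrite /= addrC addKr; near: e.
Unshelve. all: by end_near. Qed.

Lemma cvg_powR_at_right s : 0 < s -> (x - x0) `^ s @[x --> x0^'+] --> 0.
Proof. by move=> s0; apply: cvg_comp cvg_subr_at_right (powR_cvg0 s0). Qed.

Lemma cvg_pser_powR c d : 0 < d -> cvg_below c d ->
  pser c ((x - x0) `^ alpha) @[x --> x0^'+] --> c 0%N.
Proof.
move=> d0 cc.
apply: cvg_comp (cvg_powR_at_right _ alpha_gt0) (pser_continuous0 _ _ d0 cc).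
Qed.

(** Closed form of the Frobenius series.  The power of alpha is kept separate
    from the power s, so that this is a function of t = (x - x0)^alpha. *)
Definition frobenius_sum c s x : R :=
  ((x - x0) `^ alpha) `^ s * pser c ((x - x0) `^ alpha).

Lemma powR_natM x (k : nat) :
  (x - x0) `^ (k%:R * alpha) = ((x - x0) `^ alpha) ^+ k.
Proof. by rewrite mulrC powRrM powR_mulrn// powR_ge0. Qed.

Lemma frac_seriesE c x :
  frac_series alpha x0 c x = pseries c ((x - x0) `^ alpha).
Proof.
by apply/funext => n; apply: eq_bigr => k _; rewrite powR_natM.
Qed.

Lemma powR_domain d x : x0 < x < x0 + d -> 0 < (x - x0) `^ alpha < d `^ alpha.
Proof.
move=> /andP[x0x xd].
have xx0 : 0 < x - x0 by rewrite subr_gt0.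
by rewrite powR_gt0//= gt0_ltr_powR// ?nnegrE; lra.
Qed.

Lemma cvg_frobenius_series c s d x : cvg_below c (d `^ alpha) ->
    x0 < x < x0 + d ->
  frobenius_series alpha x0 c s x @ \oo --> frobenius_sum c s x.
Proof.
move=> cc /[dup] xD /powR_domain tD; have /andP[x0x _] := xD.
have xx0 : x - x0 != 0 by rewrite gt_eqF// subr_gt0.
have h := cvgMl_tmp (a := ((x - x0) `^ alpha) `^ s) (cc _ tD).
suff -> : frobenius_series alpha x0 c s x =
    (fun n => ((x - x0) `^ alpha) `^ s * pseries c ((x - x0) `^ alpha) n).
  exact: h.
apply/funext => n; rewrite /pseries /frobenius_series /series/= mulr_sumr.
apply: eq_bigr => k _; rewrite mulrDl powRD ?xx0 ?implybT//.
by rewrite powR_natM [s * _]mulrC powRrM; ring.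
Qed.

(** The expansion at the endpoint x0 + d is what gives the radius of
    convergence d^alpha in the variable t. *)
Lemma cvg_below_frac_series c (p : R -> R) d d' : 0 < d' -> d' <= d ->
    (forall x, x0 <= x <= x0 + d -> frac_series alpha x0 c x @ \oo --> p x) ->
  cvg_below c (d' `^ alpha) /\
  forall x, x0 < x < x0 + d' -> p x = pser c ((x - x0) `^ alpha).
Proof.
move=> d'0 d'd hp; split=> [r /andP[r0 rd]|x xD].
  have := hp (x0 + d); rewrite frac_seriesE [_ + d - _]addrC addKr.
  move=> /(_ _)/cvgP cp; apply: is_cvg_pseries_inside (cp _) _; first lra.
  rewrite !ger0_norm ?powR_ge0 ?(ltW r0)// (lt_le_trans rd)//.
  by apply: ge0_ler_powR; rewrite ?nnegrE // ltW // (lt_le_trans d'0).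
apply/esym; rewrite /pser -frac_seriesE.
by apply: (cvg_lim (@norm_hausdorff _ R)); apply: hp; lra.
Qed.

(** The function [f] need only agree with the sum on the interval: in the second
    application it is a conformable derivative, known there only.  The
    constant [k] carries the factor alpha of the first application. *)
Lemma cf_derive_frobenius_sum f c s d k x : cvg_below c (d `^ alpha) ->
    x0 < x < x0 + d ->
    (forall z, x0 < z < x0 + d -> f z = k * frobenius_sum c s z) ->
  cf_derivable alpha x0 f x /\
  cf_derive alpha x0 f x =
    alpha * k * frobenius_sum (fun n => (n%:R + s) * c n) (s - 1) x.
Proof.
move=> cc xD fE; have /andP[x0x xd] := xD; have tD := powR_domain _ _ xD.
have [df dfE] : cf_derivable_gt alpha x0 f x /\ cf_derive_gt alpha x0 f x =
    alpha * (k * frobenius_sum (fun n => (n%:R + s) * c n) (s - 1) x).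
  apply: (cf_derive_gt_comp _ _ _ (fun t => k *: (t `^ s * pser c t))) => //.
    apply: (is_deriveZ (f := fun t => t `^ s * pser c t)).
    exact: powR_pser_is_derive cc tD.
  near=> z; rewrite fE//; apply/andP; split; near: z.
    exact: lt_nbhsr.
  exact: lt_nbhsl.
by rewrite /cf_derivable /cf_derive gt_eqF// dfE mulrA.
Unshelve. all: by end_near. Qed.

Lemma frobenius_factorE c s x : x0 < x ->
  frobenius_factor alpha x0 s (frobenius_sum c s) x = pser c ((x - x0) `^ alpha).
Proof.
move=> x0x; rewrite /frobenius_factor /frobenius_sum -powRrM mulrA.
rewrite [s * _]mulrC powRN mulVf ?mul1r//.
by rewrite gt_eqF// powR_gt0// subr_gt0.
Qed.

(** For x > x0 the factor z is the power series in t, with conformable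
    derivative alpha times the formal derivative; both are continuous at
    t = 0. *)
Lemma frobenius_initial_conditions c s d : 0 < d -> cvg_below c (d `^ alpha) ->
  initial_conditions alpha x0 s c (frobenius_sum c s).
Proof.
move=> d0 cc; have dalpha := powR_gt0 alpha d0.
have zE : \forall x \near x0^'+,
    cf_derivable_gt alpha x0 (frobenius_factor alpha x0 s (frobenius_sum c s)) x /\
    cf_derive_gt alpha x0 (frobenius_factor alpha x0 s (frobenius_sum c s)) x =
      alpha * pser (pseries_diffs c) ((x - x0) `^ alpha).
  near=> x; have x0x : x0 < x by near: x; exact: nbhs_right_gt.
  have xd : x < x0 + d by near: x; apply: nbhs_right_lt; rewrite ltrDl.
  have /andP[t0 td] := powR_domain _ _ (introT andP (conj x0x xd)).
  apply: (cf_derive_gt_comp _ _ _ (pser c)) => //.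
    by apply: pser_is_derive cc _; rewrite gtr0_norm.
  near=> z; apply: frobenius_factorE; near: z; exact: lt_nbhsr.
have dz : cf_derive_gt alpha x0 (frobenius_factor alpha x0 s (frobenius_sum c s)) x
    @[x --> x0^'+] --> alpha * c 1%N.
  have := cvg_pser_powR _ _ dalpha (cvg_below_diffs _ _ cc).
  rewrite {2}/pseries_diffs mul1r => /(cvgMl_tmp (a := alpha)).
  move=> /(_ _); apply: cvg_trans; apply: near_eq_cvg.
  by apply: filterS zE => x [_ ->].
split.
- apply: cvg_trans (cvg_pser_powR _ _ dalpha cc); apply: near_eq_cvg.
  near=> x; apply/esym/frobenius_factorE; near: x; exact: nbhs_right_gt.
(* At x0 itself: 0 `^ 0 = 1 by convention, and 0 `^ alpha = 0. *)
- move=> ->; rewrite /frobenius_sum powRr0 mul1r subrr powR0 ?pser0//.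
  by rewrite gt_eqF.
- rewrite /cf_derivable eqxx; split; first by apply: filterS zE => x [].
  by apply/cvg_ex; exists (alpha * c 1%N).
- by rewrite /cf_derive eqxx; exact: (cvg_lim (@norm_hausdorff _ R)).
Unshelve. all: by end_near. Qed.

Lemma frobenius_solution (p q : R -> R) (pc qc : nat -> R) d1 d2 s s' b :
    let d := Num.min d1 d2 in
    0 < d1 -> 0 < d2 ->
    (forall x, x0 <= x <= x0 + d1 -> frac_series alpha x0 pc x @ \oo --> p x) ->
    (forall x, x0 <= x <= x0 + d2 -> frac_series alpha x0 qc x @ \oo --> q x) ->
    (forall r, indicial0 alpha pc qc r = alpha ^+ 2 * (r - s) * (r - s')) ->
    (forall k : nat, (0 < k)%N -> k%:R + s != s') ->
  exists c y, [/\ c 0%N = b,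
    frobenius_coefs alpha pc qc s c,
    (forall x, x0 < x < x0 + d ->
       frobenius_series alpha x0 c s x @ \oo --> y x),
    is_solution_on alpha x0 [set x | x0 < x < x0 + d] p q y &
    initial_conditions alpha x0 s c y].
Proof.
move=> d d10 d20 hp hq ind0E ss'.
have d0 : 0 < d by rewrite lt_min d10.
have dd1 : d <= d1 by rewrite ge_min lexx.
have dd2 : d <= d2 by rewrite ge_min lexx orbT.
have [pcv pE] := cvg_below_frac_series _ _ _ _ d0 dd1 hp.
have [qcv qE] := cvg_below_frac_series _ _ _ _ d0 dd2 hq.
have ind0s : indicial0 alpha pc qc s = 0 by rewrite ind0E subrr mulr0 mul0r.
have ind0k (k : nat) : (0 < k)%N -> indicial0 alpha pc qc (k%:R + s) != 0.
  move=> k0; rewrite ind0E addrK; apply: mulf_neq0; last by rewrite subr_eq0 ss'.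
  by apply: mulf_neq0; rewrite ?expf_neq0 ?(gt_eqF alpha_gt0)// pnatr_eq0 -lt0n.
have [c c0 cE] := frobenius_coefs_exist alpha pc qc s b.
have ccv : cvg_below c (d `^ alpha).
  apply: (frobenius_coefs_cvg _ _ _ alpha_gt0 _ s s') pcv qcv _ cE => k.
  by rewrite ind0E addrK.
exists c, (frobenius_sum c s); split => //.
- by move=> x; exact: cvg_frobenius_series.
- move=> x xD; have /andP[x0x _] := xD.
  have tD := powR_domain _ _ xD; have /andP[t0 _] := tD.
  have dcv := cvg_below_mulnD _ _ s ccv.
  have fE z : x0 < z < x0 + d -> frobenius_sum c s z = 1 * frobenius_sum c s z.
    by rewrite mul1r.
  have dE z (zD : x0 < z < x0 + d) := cf_derive_frobenius_sum _ _ _ _ _ z ccv zD fE.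
  have [ddy ddE] := cf_derive_frobenius_sum _ _ _ _ _ x dcv xD (fun z zD => (dE z zD).2).
  have [dy dyE] := dE x xD.
  split=> //; rewrite ddE dyE pE// qE//.
  have := frobenius_ode _ _ _ _ s c _ pcv qcv ccv ind0s ind0k cE tD.
  rewrite [2 * alpha]mulrC powRrM powR_mulrn ?powR_ge0// /frobenius_sum.
  set t := (x - x0) `^ alpha in t0 *.
  have t_neq0 : t != 0 by rewrite gt_eqF.
  have powB1 r : t `^ (r - 1) = t `^ r / t.
    by rewrite powRB ?t_neq0 ?implybT// powRr1// ltW.
  rewrite !powB1 => ode; rewrite -[RHS](mulr0 (t `^ s)) -ode.
  by field.
- exact: frobenius_initial_conditions d0 ccv.
Qed.

End Frobenius.
(** * Linear independence and the two exponents *)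

(** Multiplying a relation u y1 + v y2 = 0 by (x - x0)^(- s2 alpha) turns it into
    u (x - x0)^((s1 - s2) alpha) z1 + v z2 = 0, whose limit at x0 is v c2_0. *)
Lemma frobenius_lin_indep (R : realType) (alpha x0 d s1 s2 : R)
    (c1 c2 : nat -> R) (y1 y2 : R -> R) :
    0 < alpha -> 0 < d -> s2 < s1 -> c1 0%N != 0 -> c2 0%N != 0 ->
    initial_conditions alpha x0 s1 c1 y1 ->
    initial_conditions alpha x0 s2 c2 y2 ->
  lin_indep_on [set x | x0 < x < x0 + d] y1 y2.
Proof.
move=> alpha0 d0 s21 c10 c20 [z1 _ _ _] [z2 _ _ _] u v uv.
have D0 : \forall x \near x0^'+, x0 < x < x0 + d.
  near=> x; apply/andP; split; near: x; first exact: nbhs_right_gt.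
  by apply: nbhs_right_lt; rewrite ltrDl.
have v0 : v = 0.
  have sa0 : 0 < (s1 - s2) * alpha by rewrite mulr_gt0// subr_gt0.
  have h := cvgD (cvgMl_tmp (a := u)
    (cvgM (cvg_powR_at_right x0 _ sa0) z1)) (cvgMl_tmp (a := v) z2).
  have /(mulIf c20)// : v * c2 0%N = 0 * c2 0%N.
  rewrite mul0r -[LHS]add0r -[X in X + _](mulr0 u) -[X in u * X](mul0r (c1 0%N)).
  rewrite -(cvg_lim (@norm_hausdorff _ R) (h _ _ _ _ )).
  apply: lim_near_cst => //; apply: filterS D0 => x xD.
  have /andP[x0x _] := xD; have xx0 : x - x0 != 0 by rewrite gt_eqF// subr_gt0.
  rewrite !fctE /frobenius_factor -[RHS](mulr0 ((x - x0) `^ (- (s2 * alpha)))).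
  rewrite -(uv x xD) [_ `^ - (s2 * _)](_ : _ = (x - x0) `^ ((s1 - s2) * alpha) *
    (x - x0) `^ (- (s1 * alpha))); first by rewrite /=; ring.
  by rewrite -powRD ?xx0 ?implybT//; congr (_ `^ _); ring.
split => //; have h := cvgMl_tmp (a := u) z1.
have /(mulIf c10)// : u * c1 0%N = 0 * c1 0%N.
rewrite mul0r -(cvg_lim (@norm_hausdorff _ R) (h _)).
apply: lim_near_cst => //; apply: filterS D0 => x xD.
by rewrite /frobenius_factor mulrCA; have := uv x xD; rewrite v0 mul0r addr0 => ->; rewrite mulr0.
Unshelve. all: by end_near. Qed.

(** Vieta in the form of Lagrange interpolation: a quadratic polynomial with
    leading coefficient alpha^2 is determined by its values at s1 and s2. *)
Lemma indicial0_factor (R : realType) (alpha : R) (pc qc : nat -> R) (s1 s2 r : R) :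
    s1 != s2 -> indicial0 alpha pc qc s1 = 0 -> indicial0 alpha pc qc s2 = 0 ->
  indicial0 alpha pc qc r = alpha ^+ 2 * (r - s1) * (r - s2).
Proof.
rewrite -subr_eq0 => s12 h1 h2; apply: (mulfI s12).
transitivity ((s1 - s2) * indicial0 alpha pc qc r
  - (r - s2) * indicial0 alpha pc qc s1 + (r - s1) * indicial0 alpha pc qc s2).
  by rewrite h1 h2; ring.
by rewrite /indicial0; ring.
Qed.

Theorem theorem3p1 (R : realType) (alpha x0 : R) (p q : R -> R)
    (pc qc : nat -> R) (d1 d2 s1 s2 : R)
    (halpha : 0 < alpha <= 1)
    (hsing : regular_alpha_singular alpha x0
       (fun x => p x / (x - x0) `^ alpha)
       (fun x => q x / (x - x0) `^ (2 * alpha)))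
    (hd1 : 0 < d1) (hd2 : 0 < d2)
    (hp : forall x, x0 <= x <= x0 + d1 ->
       frac_series alpha x0 pc x @ \oo --> p x)
    (hq : forall x, x0 <= x <= x0 + d2 ->
       frac_series alpha x0 qc x @ \oo --> q x)
    (hs : s2 < s1)
    (hs1 : indicial0 alpha pc qc s1 = 0)
    (hs2 : indicial0 alpha pc qc s2 = 0)
    (hdiff : forall n : nat, s1 - s2 <> n%:R)
    (b1 b2 : R) (hb1 : b1 <> 0) (hb2 : b2 <> 0) :
  let D := [set x : R | x0 < x < x0 + Num.min d1 d2] in
  exists (c1 c2 : nat -> R) (y1 y2 : R -> R),
    (c1 0%N = b1 /\ c2 0%N = b2) /\
    (frobenius_coefs alpha pc qc s1 c1 /\ frobenius_coefs alpha pc qc s2 c2) /\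
    (forall x, D x ->
       frobenius_series alpha x0 c1 s1 x @ \oo --> y1 x /\
       frobenius_series alpha x0 c2 s2 x @ \oo --> y2 x) /\
    (is_solution_on alpha x0 D p q y1 /\ is_solution_on alpha x0 D p q y2) /\
    (initial_conditions alpha x0 s1 c1 y1 /\
     initial_conditions alpha x0 s2 c2 y2) /\
    lin_indep_on D y1 y2.
Proof.
move=> D; have /andP[alpha0 _] := halpha.
have s12 : s1 != s2 by rewrite gt_eqF.
have s21 : s2 != s1 by rewrite lt_eqF.
have sep1 (k : nat) : (0 < k)%N -> k%:R + s1 != s2.
  by rewrite -(ltr0n R) => k0; apply/eqP; lra.
have sep2 (k : nat) : (0 < k)%N -> k%:R + s2 != s1.
  by move=> _; apply/eqP => ks; apply: (hdiff k); rewrite -ks addrK.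
have [c1 [y1 [c10 cE1 ser1 sol1 ini1]]] := frobenius_solution alpha x0 alpha0 p q
  pc qc d1 d2 s1 s2 b1 hd1 hd2 hp hq
  (fun r => indicial0_factor _ _ _ _ _ _ r s12 hs1 hs2) sep1.
have [c2 [y2 [c20 cE2 ser2 sol2 ini2]]] := frobenius_solution alpha x0 alpha0 p q
  pc qc d1 d2 s2 s1 b2 hd1 hd2 hp hq
  (fun r => indicial0_factor _ _ _ _ _ _ r s21 hs2 hs1) sep2.
exists c1, c2, y1, y2; split => //; split => //; split.
  by move=> x xD; split; [exact: ser1|exact: ser2].
split => //; split => //.
apply: frobenius_lin_indep alpha0 _ hs _ _ ini1 ini2; first by rewrite lt_min hd1.
  by rewrite c10; apply/eqP.
by rewrite c20; apply/eqP.
Qed.
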